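(* Let $T$ be a tree with $n \geq 2$ vertices. Then $$\tilde{\gamma}_{c}(M(T)) = n.$$
   Context: All graphs are non-empty, finite, undirected and simple. A dominating set of a graph $H$ is a set $S \subseteq V(H)$ such that $N_H[v] \cap S \neq \emptyset$ for every $v \in V(H)$, where $N_H[v]$ is the closed neighborhood of $v$. A dominating set $S$ of $H$ is an outer-connected dominating set if the graph $H - S$ (obtained by deleting the vertices in $S$) is connected. The outer-connected domination number $\tilde{\gamma}_c(H)$ is the minimum cardinality of an outer-connected dominating set of $H$. The middle graph $M(G)$ of a graph $G$ is the graph with vertex set $V(G) \cup E(G)$ (disjoint union), in which two vertices $x,y$ are adjacent if and only if either $x,y \in E(G)$ are distinct edges sharing an endpoint in $G$, or one of them is a vertex of $G$ and the other is an edge of $G$ incident with it. *)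

(* Defs.v *)
From mathcomp Require Import all_boot.

Set Implicit Arguments.
Unset Strict Implicit.
Unset Printing Implicit Defensive.

Record sgraph := SGraph {
  vertex :> finType;
  adj : rel vertex;
  adj_sym : symmetric adj;
  adj_irrefl : irreflexive adj
}.

Section Graphs.
Variable G : sgraph.
Implicit Types S : {set G}.

(* The structure sgraph allows an empty vertex set; a connected graph is
   required to be nonempty. *)
Definition connected_graph : bool :=
  (0 < #|G|) && [forall x : G, forall y : G, connect (@adj G) x y].

Definition acyclic_graph : Prop :=
  forall c : seq G, 2 < size c -> ~ ucycle (@adj G) c.

Definition is_tree : Prop := connected_graph /\ acyclic_graph.

Definition closed_neighborhood (v : G) : {set G} :=
  [set u | (u == v) || adj v u].

Definition dominating S : bool :=
  [forall v : G, closed_neighborhood v :&: S != set0].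

Definition del_adj S : rel {x : G | x \notin S} :=
  fun x y => adj (val x) (val y).

Lemma del_adj_sym S : symmetric (@del_adj S).
Proof. by move=> x y; apply: adj_sym. Qed.

Lemma del_adj_irrefl S : irreflexive (@del_adj S).
Proof. by move=> x; apply: adj_irrefl. Qed.

Definition del_vertices S : sgraph :=
  SGraph (@del_adj_sym S) (@del_adj_irrefl S).

End Graphs.

Definition outer_connected_dominating (G : sgraph) (S : {set G}) : bool :=
  dominating S && connected_graph (del_vertices S).

(* No set of vertices has more than #|G| elements, so the neutral value #|G|
   does not affect the minimum; it is the value of the number when no
   outer-connected dominating set exists. *)
Definition outer_connected_domination_number (G : sgraph) : nat :=
  \big[minn/#|G|]_(S : {set G} | outer_connected_dominating S) #|S|.

Section MiddleGraph.
Variable G : sgraph.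

Definition is_edge (e : {set G}) : bool :=
  [exists x : G, exists y : G, adj x y && (e == [set x; y])].

Definition edge : finType := {e : {set G} | is_edge e}.

Definition middle_adj (a b : G + edge) : bool :=
  match a, b with
  | inl _, inl _ => false
  | inl v, inr e => v \in val e
  | inr e, inl v => v \in val e
  | inr e, inr f => (e != f) && (val e :&: val f != set0)
  end.

Lemma middle_adj_sym : symmetric middle_adj.
Proof. by move=> [v|e] [w|f] //=; rewrite eq_sym setIC. Qed.

Lemma middle_adj_irrefl : irreflexive middle_adj.
Proof. by move=> [v|e] //=; rewrite eqxx. Qed.

Definition middle_graph : sgraph := SGraph middle_adj_sym middle_adj_irrefl.

End MiddleGraph.

(* Main.v *)
Require Import Defs.
From mathcomp Require Import all_boot.

(** The set of all original vertices is an outer-connected dominating set of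
    M(T): deleting it leaves the line graph of T, which is connected because a
    walk in T can be followed edge by edge
    ([original_vertices_outer_connected_dominating]).  This gives the upper
    bound n.

    For the lower bound, let S be an outer-connected dominating set and inject
    V(T) into S.  A vertex lying in S is sent to itself.  A vertex v outside S
    is dominated by S, and its neighbours in M(T) are edges, so v is sent to
    some edge of S incident with v.  Two vertices v <> w can only collide when
    the edge e = vw belongs to S while v and w both survive in M(T) - S.  As
    M(T) - S is connected, it contains a walk from v to w, and this walk
    projects to a walk of T that does not use e ([connect_avoiding]); closed up
    by e it yields a cycle ([acyclic_bridge]), which a tree does not have. *)

Set Implicit Arguments.
Unset Strict Implicit.
Unset Printing Implicit Defensive.

Lemma bigminn_le (I : finType) (P : pred I) (F : I -> nat) x j :
  P j -> \big[minn/x]_(i | P i) F i <= F j.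
Proof.
move=> Pj; have: j \in index_enum I by rewrite mem_index_enum.
elim: (index_enum I) => // a s IHs; rewrite inE big_cons.
case/predU1P=> [<- | /IHs le_s]; first by rewrite Pj geq_minl.
by case: ifP => // _; rewrite geq_min le_s orbT.
Qed.

Definition survivor (G : sgraph) (S : {set G}) (a : G) (aS : a \notin S) :
  del_vertices S := exist _ a aS.

Section MiddleGraph.
Variable G : sgraph.
Implicit Types (x y u v w : G) (e f : edge G) (S : {set middle_graph G}).

Lemma edgeP e : exists x y, adj x y /\ val e = [set x; y].
Proof.
by case: e => e /= /existsP[x /existsP[y /andP[xy /eqP->]]]; exists x, y.
Qed.

Lemma is_edge_adj x y : adj x y -> is_edge [set x; y].
Proof.
by move=> xy; apply/existsP; exists x; apply/existsP; exists y; rewrite xy eqxx.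
Qed.

Definition edge_of x y (xy : adj x y) : edge G :=
  exist _ [set x; y] (is_edge_adj xy).

Lemma edge_endpoints e v w :
  v \in val e -> w \in val e -> v != w -> adj v w /\ val e = [set v; w].
Proof.
have [x [y [xy ->]]] := edgeP e; rewrite !inE.
case/orP=> /eqP-> /orP[] /eqP->; rewrite ?eqxx // => _.
by rewrite adj_sym setUC.
Qed.

Definition adj_avoiding (A : {set G}) : rel G :=
  fun x y => adj x y && ([set x; y] != A).

(** Every edge of an acyclic graph is a bridge: a path joining its ends without
    using it has length at least two, so the edge closes it to a cycle. *)
Lemma acyclic_bridge v w :
  acyclic_graph G -> adj v w -> ~~ connect (adj_avoiding [set v; w]) v w.
Proof.
move=> acyc vw; apply/negP => /connectP[p0 /shortenP[p pP Up _] def_w].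
have [lt1p | ] := ltnP 1 (size p).
  apply: (acyc (v :: p)); first by rewrite /= ltnS.
  rewrite /ucycle Up andbT /= rcons_path -def_w [adj w v]adj_sym vw andbT.
  by apply: sub_path pP => x y /andP[].
case: p pP {Up} def_w => [|y [|//]] /= => [_ | /andP[/andP[_ ne] _]] def_w _.
  by rewrite def_w adj_irrefl in vw.
by rewrite def_w eqxx in ne.
Qed.

(** Walks of M(G) - S project to walks of G: passing through a surviving edge f
    moves between the ends of f, and f differs from the deleted edge e.  The
    induction along the walk needs, when it stands at an edge, that both ends
    of this edge are reachable. *)
Lemma connect_avoiding S e v w
    (vS : (inl v : middle_graph G) \notin S)
    (wS : (inl w : middle_graph G) \notin S) :
  inr e \in S -> connected_graph (del_vertices S) ->
  connect (adj_avoiding (val e)) v w.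
Proof.
move=> eS /andP[_ /forallP/(_ (survivor vS))/forallP/(_ (survivor wS))].
set C := connect (adj_avoiding _).
have edge_step f x y : inr f \notin S -> x \in val f -> y \in val f ->
    C v x -> C v y.
  move=> fS xf yf vx; have [<- // | ne] := eqVneq x y.
  have [xy def_f] := edge_endpoints xf yf ne.
  apply: connect_trans vx (connect1 _); rewrite /adj_avoiding xy -def_f /=.
  by apply: contraNneq fS => /val_inj->.
pose reached (a : middle_graph G) : Prop :=
  match a with inl u => C v u | inr f => forall u, u \in val f -> C v u end.
suff inv (a : del_vertices S) p : path (@adj _) a p -> reached (val a) ->
    reached (val (last a p)).
  case/connectP=> p /inv pP def_w.
  by have := pP (connect0 _ _); rewrite -def_w.
elim: p a => //= b p IHp a /andP[ab /IHp {}IHp] Ra; apply: IHp.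
move: a b ab Ra => [[u|f] aS] [[u'|f'] bS] //=; rewrite /Defs.del_adj /=.
- by move=> uf' vu u2 u2f'; apply: edge_step uf' u2f' vu.
- by move=> u'f Rf; apply: Rf.
move=> /andP[_ /set0Pn[x /setIP[xf xf']]] Rf u uf'.
exact: edge_step xf' uf' (Rf x xf).
Qed.

Lemma dominated_by_incident_edge S v :
  dominating S -> inl v \notin S -> exists2 e, inr e \in S & v \in val e.
Proof.
move=> /forallP/(_ (inl v))/set0Pn[a /setIP[]]; rewrite inE => va aS vS.
case: a va aS => [u | e] /=; last by exists e.
by rewrite orbF => /eqP-> uS; rewrite uS in vS.
Qed.

(** The map [repr] below keeps the vertices of S and sends any other vertex to
    an incident edge of S; two vertices sharing the same edge of S would both
    survive in M(G) - S, where connectivity makes that edge lie on a cycle. *)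
Lemma outer_connected_dominating_ge S :
  acyclic_graph G -> outer_connected_dominating S -> #|G| <= #|S|.
Proof.
move=> acyc /andP[domS connS].
pose repr v : middle_graph G :=
  if [pick e : edge G | (inr e \in S) && (v \in val e)] is Some e then
    if inl v \in S then inl v else inr e
  else inl v.
have reprP v : repr v \in S /\
    (repr v = inl v \/
     exists2 e, repr v = inr e & v \in val e /\ inl v \notin S).
  rewrite /repr; case: pickP => [e /andP[eS ve] | no_e].
    by case: ifPn => vS; split; auto; right; exists e.
  split; last by left.
  apply/negPn/negP => /(dominated_by_incident_edge domS)[e eS ve].
  by have := no_e e; rewrite eS ve.
have repr_inj : injective repr.
  move=> v w eq_vw; have [vS Rv] := reprP v; have [_ Rw] := reprP w.
  case: Rv Rw => [Rv | [e Rv [ve nvS]]] [Rw | [e' Rw [we nwS]]].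
  - by move: eq_vw; rewrite Rv Rw => -[].
  - by move: eq_vw; rewrite Rv Rw.
  - by move: eq_vw; rewrite Rv Rw.
  have {Rw} def_e : e' = e by move: eq_vw; rewrite Rv Rw => -[].
  rewrite {}def_e in we; have [// | ne] := eqVneq v w.
  have [vw def_e] := edge_endpoints ve we ne; rewrite Rv in vS.
  have := connect_avoiding nvS nwS vS connS.
  by rewrite def_e (negPf (acyclic_bridge _ _)).
rewrite -(card_codom repr_inj); apply/subset_leq_card/subsetP.
by move=> _ /codomP[v ->]; case: (reprP v).
Qed.

Definition original_vertices : {set middle_graph G} :=
  [set inl v | v : G].

Lemma card_original_vertices : #|original_vertices| = #|G|.
Proof. by rewrite card_imset // => x y []. Qed.

Lemma inr_notin_original e : (inr e : middle_graph G) \notin original_vertices.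
Proof. by apply/imsetP => -[]. Qed.

(* The vertices of the line graph of G, seen as what is left of M(G). *)
Let line_vertex e : del_vertices original_vertices :=
  survivor (inr_notin_original e).

(** A walk v, y, ..., of G lifts to the line graph: the edges f and vy share v,
    and the walk from y onwards is lifted starting from vy. *)
Lemma connect_line v p f e : path (@adj G) v p ->
  v \in val f -> last v p \in val e ->
  connect (@adj (del_vertices original_vertices))
    (line_vertex f) (line_vertex e).
Proof.
have share x f1 f2 : x \in val f1 -> x \in val f2 ->
    connect (@adj (del_vertices original_vertices))
      (line_vertex f1) (line_vertex f2).
  move=> xf1 xf2; have [-> | ne] := eqVneq f1 f2; first exact: connect0.
  apply: connect1; rewrite /= /Defs.del_adj /= ne /=.
  by apply/set0Pn; exists x; rewrite inE xf1.
elim: p v f => [|y p IHp] v f /=; first by move=> _; apply: share.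
case/andP=> vy /IHp {}IHp vf we.
pose h := edge_of vy.
by apply: connect_trans (share v f h vf _) (IHp h _ we);
  rewrite !inE eqxx ?orbT.
Qed.

Lemma original_vertices_outer_connected_dominating :
  connected_graph G -> 2 <= #|G| ->
  outer_connected_dominating original_vertices.
Proof.
move=> /andP[_ /forallP connG] /card_gt1P[x [y [_ _ ne_xy]]].
apply/andP; split.
  apply/forallP => -[v | e]; apply/set0Pn.
    by exists (inl v); rewrite !inE eqxx imset_f.
  have [u [w [_ def_e]]] := edgeP e; exists (inl u).
  by rewrite !inE /= def_e !inE eqxx imset_f.
apply/andP; split.
  have /forallP/(_ y)/connectP[[|z p] /= pP def_y] := connG x.
    by rewrite def_y eqxx in ne_xy.
  have /andP[xz _] := pP.
  by apply/card_gt0P; exists (line_vertex (edge_of xz)).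
apply/forallP => -[[v | f] fS]; first by case/imsetP: (fS); exists v.
apply/forallP => -[[v | e] eS]; first by case/imsetP: (eS); exists v.
have [v [v' [_ def_f]]] := edgeP f; have [w [w' [_ def_e]]] := edgeP e.
have /forallP/(_ w)/connectP[p pP def_w] := connG v.
have := @connect_line v p f e pP; rewrite -def_w def_f def_e !inE !eqxx.
move/(_ isT isT); congr (connect _ _ _); exact: val_inj.
Qed.

End MiddleGraph.

Theorem theorem4p3 (T : sgraph) (n : nat) :
  is_tree T -> #|T| = n -> 2 <= n ->
  outer_connected_domination_number (middle_graph T) = n.
Proof.
move=> [connT acycT] <- T_gt1; apply/eqP; rewrite eqn_leq; apply/andP; split.
  rewrite -card_original_vertices; apply: bigminn_le.
  exact: original_vertices_outer_connected_dominating.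
apply: (big_ind (leq #|T|)) => [|a b Ta Tb|S]; last 1 first.
- exact: outer_connected_dominating_ge.
- by rewrite -card_original_vertices max_card.
by rewrite leq_min Ta.
Qed.
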